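(* Let $P$ be a poset and let $\mathcal{I}$ be a collection of intervals in $P$. The minimal rank decomposition $(\mathcal{R}^*,\mathcal{S}^* )$ over $\mathcal{I}$ of any map $r\colon \mathcal{I}\to\mathbb{Z}$ is unique if it exists. Furthermore, if a rank decomposition $(\mathcal{R},\mathcal{S})$ of $r$ over $\mathcal{I}$ exists, then a minimal one exists and is obtained from it by removing common intervals, that is: \[ (\mathcal{R}^*,\mathcal{S}^* ) = (\mathcal{R}\setminus(\mathcal{R}\cap\mathcal{S}),\ \mathcal{S}\setminus(\mathcal{R}\cap\mathcal{S})), \] where intersection and difference are those of multi-sets.
   Context: Fix a field $\mathbf{k}$. A poset $P$ is viewed as a category; $\operatorname{Rep}P$ is the category of functors $P\to\mathrm{Vec}_{\mathbf{k}}$. An interval in $P$ is a non-empty subset $I$ that is convex ($s\le u\le t$ with $s,t\in I$ implies $u\in I$) and connected (any two elements of $I$ are joined by a finite sequence of elements of $I$ with consecutive ones comparable). $\mathbf{k}_I$ is the representation equal to $\mathbf{k}$ on $I$ and $0$ elsewhere, with identity maps between comparable elements of $I$. For a multi-set $\mathcal{R}$ of intervals, $\mathbf{k}_{\mathcal{R}}=\bigoplus_{R\in\mathcal{R}}\mathbf{k}_R$ (with multiplicity). For $M\in\operatorname{Rep}P$ and an interval $I$, the generalized rank is $\operatorname{Rk}_I M=\operatorname{rank}\left[\varprojlim M|_I\to\varinjlim M|_I\right]\in\mathbb{N}\cup\{\infty\}$ (the canonical map). For a collection $\mathcal{I}$ of intervals, $\operatorname{Rk}_{\mathcal{I}}M\colon\mathcal{I}\to\mathbb{N}\cup\{\infty\}$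 is $I\mapsto\operatorname{Rk}_I M$, and $\operatorname{rep}_{\mathcal{I}}P\subseteq \operatorname{Rep}P$ is the full subcategory of those $M$ for which $\operatorname{Rk}_{\mathcal{I}}M$ takes only finite values. A rank decomposition of $r\colon\mathcal{I}\to\mathbb{Z}$ over $\mathcal{I}$ is a pair $(\mathcal{R},\mathcal{S})$ of multi-sets of elements of $\mathcal{I}$ with $\mathbf{k}_{\mathcal{R}},\mathbf{k}_{\mathcal{S}}\in\operatorname{rep}_{\mathcal{I}}P$ and $r=\operatorname{Rk}_{\mathcal{I}}\mathbf{k}_{\mathcal{R}}-\operatorname{Rk}_{\mathcal{I}}\mathbf{k}_{\mathcal{S}}$. It is minimal if $\mathcal{R}$ and $\mathcal{S}$ are disjoint as multi-sets. *)

(* Defs.v *)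
From HB Require Import structures.
From mathcomp Require Import all_boot all_order all_algebra.
From mathcomp Require Import boolp classical_sets functions cardinality.
From mathcomp Require Import ring_quotient.

Set Implicit Arguments.
Unset Strict Implicit.
Unset Printing Implicit Defensive.

Import Order.TTheory GRing.Theory.
Local Open Scope classical_set_scope.
Local Open Scope ring_scope.

Section Product.
Variables (k : fieldType) (J : Type) (M : J -> lmodType k).

Definition prodmod := forall j, M j.
HB.instance Definition _ := Choice.on prodmod.

Implicit Types f g h : prodmod.
Let add f g : prodmod := fun j => f j + g j.
Let zero : prodmod := fun j => 0.
Let opp f : prodmod := fun j => - f j.
Let scale (a : k) f : prodmod := fun j => a *: f j.

Fact prodmod_addA : associative add.
Proof. by move=> f g h; apply: functional_extensionality_dep => j; apply: addrA. Qed.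
Fact prodmod_addC : commutative add.
Proof. by move=> f g; apply: functional_extensionality_dep => j; apply: addrC. Qed.
Fact prodmod_add0 : left_id zero add.
Proof. by move=> f; apply: functional_extensionality_dep => j; apply: add0r. Qed.
Fact prodmod_addN : left_inverse zero opp add.
Proof. by move=> f; apply: functional_extensionality_dep => j; apply: addNr. Qed.
HB.instance Definition _ := GRing.isZmodule.Build prodmod
  prodmod_addA prodmod_addC prodmod_add0 prodmod_addN.

Fact prodmod_scaleA a b f : scale a (scale b f) = scale (a * b) f.
Proof. by apply: functional_extensionality_dep => j; apply: scalerA. Qed.
Fact prodmod_scale1 : left_id 1 scale.
Proof. by move=> f; apply: functional_extensionality_dep => j; apply: scale1r. Qed.
Fact prodmod_scaleDr : right_distributive scale +%R.
Proof. by move=> a f g; apply: functional_extensionality_dep => j; apply: scalerDr. Qed.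
Fact prodmod_scaleDl f : {morph scale^~ f : a b / a + b}.
Proof. by move=> a b; apply: functional_extensionality_dep => j; apply: scalerDl. Qed.
HB.instance Definition _ := GRing.Zmodule_isLmodule.Build k prodmod
  prodmod_scaleA prodmod_scale1 prodmod_scaleDr prodmod_scaleDl.

Lemma prodmodD f g j : (f + g) j = f j + g j. Proof. by []. Qed.
Lemma prodmodZ a f j : (a *: f) j = a *: f j. Proof. by []. Qed.
Lemma prodmod0 j : (0 : prodmod) j = 0. Proof. by []. Qed.

Definition finite_support : pred prodmod :=
  fun f => `[< finite_set [set j | f j != 0] >].

Fact finite_support_closed : submod_closed finite_support.
Proof.
split=> [|a f g].
  apply/asboolP; rewrite (_ : [set _ | _] = set0) //.
  by apply/seteqP; split=> j //=; rewrite prodmod0 eqxx.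
move=> /asboolP fin_f /asboolP fin_g; apply/asboolP.
have fin_fg := conj fin_f fin_g; rewrite -finite_setU in fin_fg.
apply: sub_finite_set fin_fg => j /= nz.
case: (eqVneq (f j) 0) => [fj0|]; last by left.
by right; apply: contraNneq nz => gj0; rewrite prodmodD prodmodZ fj0 gj0 scaler0 addr0.
Qed.
HB.instance Definition _ :=
  GRing.isSubmodClosed.Build k prodmod finite_support finite_support_closed.

Definition dirsum := {f : prodmod | finite_support f}.
HB.instance Definition _ := SubType.on dirsum.
HB.instance Definition _ := Choice.on dirsum.
HB.instance Definition _ := [SubChoice_isSubLmodule of dirsum by <:].

End Product.

Section DirsumMap.
Variables (k : fieldType) (J : Type) (M N : J -> lmodType k).
Variable u : forall j, {linear M j -> N j}.

Fact dirsum_map_subproof (f : dirsum M) :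
  finite_support (fun j => u j (\val f j) : N j).
Proof.
apply/asboolP; have /asboolP := valP f; apply: sub_finite_set => j /=.
by apply: contraNneq => ->; rewrite linear0.
Qed.

Definition dirsum_map (f : dirsum M) : dirsum N := Sub _ (dirsum_map_subproof f).

Fact dirsum_map_is_linear : linear dirsum_map.
Proof.
by move=> a f g; apply/val_inj; apply: functional_extensionality_dep => j /=; rewrite linearP.
Qed.
HB.instance Definition _ := GRing.isLinear.Build k (dirsum M) (dirsum N) _
  dirsum_map dirsum_map_is_linear.

End DirsumMap.

Section DirsumInj.
Variables (k : fieldType) (J : eqType) (M : J -> lmodType k) (i : J).

Fact dirsum_in_subproof (x : M i) :
  finite_support (dfwith (0 : prodmod M) x : prodmod M).
Proof.
apply/asboolP; apply: (@sub_finite_set _ _ [set i]); last exact: finite_set1.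
move=> j /=; apply: contraNeq => /eqP ij; rewrite dfwith_out //.
by apply/eqP => e; apply: ij.
Qed.

Definition dirsum_in (x : M i) : dirsum M := Sub _ (dirsum_in_subproof x).

Fact dirsum_in_is_linear : linear dirsum_in.
Proof.
move=> a x y; apply/val_inj; apply: functional_extensionality_dep => j.
have -> : \val (a *: dirsum_in x + dirsum_in y) j =
          a *: \val (dirsum_in x) j + \val (dirsum_in y) j by [].
case: (eqVneq i j) => [ij|ij] /=.
  by case: j / ij; rewrite !dfwith_in.
by rewrite !dfwith_out // scaler0 addr0.
Qed.
HB.instance Definition _ := GRing.isLinear.Build k (M i) (dirsum M) _
  dirsum_in dirsum_in_is_linear.

End DirsumInj.

Section Quotient.
Variables (k : fieldType) (V : lmodType k) (S : set V).

(* Membership in the linear span of S, the least subspace containing S. *)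
Definition spanned : pred V := fun v =>
  `[< forall W : set V, W 0 -> (forall a u w, W u -> W w -> W (a *: u + w)) ->
      S `<=` W -> W v >].

Fact spanned_closed : submod_closed spanned.
Proof.
split=> [|a u v /asboolP spu /asboolP spv].
  by apply/asboolP => W W0 _ _.
by apply/asboolP => W W0 WP SW; apply: (WP); [exact: spu | exact: spv].
Qed.
HB.instance Definition _ :=
  GRing.isSubmodClosed.Build k V spanned spanned_closed.

Lemma sub_spanned v : S v -> spanned v.
Proof. by move=> Sv; apply/asboolP => W _ _; apply. Qed.

Definition quotmod := Quotient.quot (GRing.ZmodClosed.clone V spanned _).
HB.instance Definition _ := GRing.Zmodule.on quotmod.
Definition quot_pi (v : V) : quotmod := (\pi_(Quotient.quot (GRing.ZmodClosed.clone V spanned _)) v)%qT.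

Lemma quot_piE u v : (quot_pi u = quot_pi v) <-> spanned (u - v).
Proof.
have e := Quotient.idealrBE (GRing.ZmodClosed.clone V spanned _) u v; split=> [/eqP|sp]; first by rewrite -e.
by apply/eqP; rewrite -e.
Qed.

Lemma quot_pi_surj (q : quotmod) : exists v, q = quot_pi v.
Proof. by exists (repr q)%qT; rewrite /quot_pi reprK. Qed.

Let scale (a : k) (q : quotmod) : quotmod := quot_pi (a *: repr q)%qT.

Fact quot_piD : {morph quot_pi : u v / u + v}.
Proof. by move=> u v; rewrite /quot_pi; exact: raddfD. Qed.

Fact quot_piZ a v : quot_pi (a *: v) = scale a (quot_pi v).
Proof.
apply/quot_piE; rewrite -scalerBr; apply: rpredZ; apply/quot_piE.
by rewrite /quot_pi reprK.
Qed.

Fact quotmod_scaleA a b q : scale a (scale b q) = scale (a * b) q.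
Proof. by have [v ->] := quot_pi_surj q; rewrite -!quot_piZ scalerA. Qed.
Fact quotmod_scale1 : left_id 1 scale.
Proof. by move=> q; have [v ->] := quot_pi_surj q; rewrite -quot_piZ scale1r. Qed.
Fact quotmod_scaleDr : right_distributive scale +%R.
Proof.
move=> a p q; have [u ->] := quot_pi_surj p; have [v ->] := quot_pi_surj q.
by rewrite -quot_piD -!quot_piZ scalerDr quot_piD.
Qed.
Fact quotmod_scaleDl q : {morph scale^~ q : a b / a + b}.
Proof.
by move=> a b; have [v ->] := quot_pi_surj q; rewrite -!quot_piZ scalerDl quot_piD.
Qed.
HB.instance Definition _ := GRing.Zmodule_isLmodule.Build k quotmod
  quotmod_scaleA quotmod_scale1 quotmod_scaleDr quotmod_scaleDl.

Fact quot_pi_is_linear : linear quot_pi.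
Proof. by move=> a u v; rewrite quot_piD quot_piZ. Qed.
HB.instance Definition _ := GRing.isLinear.Build k V quotmod _
  quot_pi quot_pi_is_linear.

End Quotient.

Record rep (k : fieldType) (d : Order.disp_t) (P : porderType d) := Rep {
  rep_obj :> P -> lmodType k;
  rep_map : forall s t, (s <= t)%O -> {linear rep_obj s -> rep_obj t};
  rep_map_id : forall s (ss : (s <= s)%O) x, rep_map ss x = x;
  rep_map_comp : forall s t u (st : (s <= t)%O) (tu : (t <= u)%O)
    (su : (s <= u)%O) x, rep_map tu (rep_map st x) = rep_map su x
}.
Arguments Rep {k d P}.
Arguments rep_map {k d P} M {s t} : rename.

Definition subposet (d : Order.disp_t) (P : porderType d) (A : set P) :=
  {p : P | p \in A}.
HB.instance Definition _ d (P : porderType d) (A : set P) :=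
  SubType.on (subposet A).
HB.instance Definition _ d (P : porderType d) (A : set P) :=
  Choice.on (subposet A).
HB.instance Definition _ d (P : porderType d) (A : set P) :=
  [SubChoice_isSubPOrder of subposet A by <: with d].

Section Restriction.
Variables (k : fieldType) (d : Order.disp_t) (P : porderType d).
Variables (A : set P) (M : rep k P).

Definition restrict : rep k (subposet A) :=
  @Rep k d (subposet A) (fun p => M (\val p))
    (fun s t st => rep_map M (st : (\val s <= \val t)%O))
    (fun s => @rep_map_id _ _ _ M (\val s))
    (fun s t u => @rep_map_comp _ _ _ M (\val s) (\val t) (\val u)).
End Restriction.

Section DirectSum.
Variables (k : fieldType) (d : Order.disp_t) (P : porderType d).
Variables (J : Type) (M : J -> rep k P).

Let obj (p : P) : lmodType k := dirsum (fun j => M j p).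
Let map s t (st : (s <= t)%O) : {linear obj s -> obj t} :=
  dirsum_map (fun j => rep_map (M j) st).

Fact rep_dirsum_id s (ss : (s <= s)%O) x : map ss x = x.
Proof.
apply/val_inj; apply: functional_extensionality_dep => j; exact: rep_map_id.
Qed.
Fact rep_dirsum_comp s t u (st : (s <= t)%O) (tu : (t <= u)%O)
  (su : (s <= u)%O) x : map tu (map st x) = map su x.
Proof.
apply/val_inj; apply: functional_extensionality_dep => j; exact: rep_map_comp.
Qed.

Definition rep_dirsum : rep k P := Rep obj map rep_dirsum_id rep_dirsum_comp.
End DirectSum.

Section Limit.
Variables (k : fieldType) (d : Order.disp_t) (Q : porderType d).
Variable M : rep k Q.

Definition compatible : pred (prodmod M) := fun x =>
  `[< forall s t (st : (s <= t)%O), rep_map M st (x s) = x t >].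

Fact compatible_closed : submod_closed compatible.
Proof.
split=> [|a x y /asboolP cx /asboolP cy]; apply/asboolP => s t st.
  by rewrite !prodmod0 linear0.
by rewrite !prodmodD !prodmodZ linearP cx cy.
Qed.
HB.instance Definition _ :=
  GRing.isSubmodClosed.Build k (prodmod M) compatible compatible_closed.

Definition lim := {x : prodmod M | compatible x}.
HB.instance Definition _ := SubType.on lim.
HB.instance Definition _ := Choice.on lim.
HB.instance Definition _ := [SubChoice_isSubLmodule of lim by <:].

Definition lim_proj (q : Q) (x : lim) : M q := \val x q.

Fact lim_proj_is_linear q : linear (lim_proj q).
Proof. by []. Qed.
HB.instance Definition _ q := GRing.isLinear.Build k lim (M q) _
  (lim_proj q) (@lim_proj_is_linear q).

Lemma lim_projP s t (st : (s <= t)%O) x :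
  rep_map M st (lim_proj s x) = lim_proj t x.
Proof. by have /asboolP := valP x; apply. Qed.

Definition colim_rel : set (dirsum M) :=
  [set v | exists s t (st : (s <= t)%O) (x : M s),
     v = dirsum_in x - dirsum_in (rep_map M st x)].

Definition colim := quotmod colim_rel.
HB.instance Definition _ := GRing.Lmodule.on colim.

Definition colim_in (q : Q) (x : M q) : colim := quot_pi colim_rel (dirsum_in x).

Fact colim_in_is_linear q : linear (@colim_in q).
Proof. by move=> a x y; rewrite /colim_in !linearP. Qed.
HB.instance Definition _ q := GRing.isLinear.Build k (M q) colim _
  (@colim_in q) (@colim_in_is_linear q).

Lemma colim_inP s t (st : (s <= t)%O) (x : M s) :
  colim_in (rep_map M st x) = colim_in x.
Proof.
by apply/esym/quot_piE/sub_spanned; exists s, t, st, x.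
Qed.

(* The composite lim M -> M q -> colim M; for connected Q it does not depend
   on q (lim_to_colim_connected), and is then the canonical map. *)
Definition lim_to_colim (q : Q) (x : lim) : colim := colim_in (lim_proj q x).

Fact lim_to_colim_is_linear q : linear (lim_to_colim q).
Proof. by move=> a x y; rewrite /lim_to_colim !linearP. Qed.
HB.instance Definition _ q := GRing.isLinear.Build k lim colim _
  (lim_to_colim q) (@lim_to_colim_is_linear q).

Lemma lim_to_colim_connected s t (p : seq Q) :
  path >=<%O s p -> last s p = t -> lim_to_colim s = lim_to_colim t.
Proof.
elim: p s => [|u p IHp] s /=; first by move=> _ ->.
case/andP=> su up lst; rewrite -(IHp _ up lst); apply/funext => x.
rewrite /lim_to_colim; case/orP: su => [su|us].
  by rewrite -(lim_projP su) colim_inP.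
by rewrite -(lim_projP us) colim_inP.
Qed.

End Limit.

Inductive enat := Fin of nat | Infty.

Definition is_finite (n : enat) : Prop := n <> Infty.

Definition fin_part (n : enat) : nat := if n is Fin m then m else 0%N.

Section Rank.
Variables (k : fieldType) (V W : lmodType k) (f : {linear V -> W}).

Definition is_basis_of (U : set W) (n : nat) (b : 'I_n -> W) : Prop :=
  (forall c : 'I_n -> k, \sum_i c i *: b i = 0 -> forall i, c i = 0) /\
  U = [set \sum_i c i *: b i | c in [set: 'I_n -> k]].

Definition has_rank (n : nat) : Prop :=
  exists b : 'I_n -> W, is_basis_of (range f) b.

Definition rank : enat :=
  if pselect (exists n, has_rank n) is left ex then Fin (sval (cid ex))
  else Infty.

Lemma basis_mem (U : set W) n (b : 'I_n -> W) i : is_basis_of U b -> U (b i).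
Proof.
case=> _ ->; exists (fun j => (j == i)%:R) => //.
rewrite (bigD1 i) //= eqxx scale1r big1 ?addr0 // => j /negPf ->.
by rewrite scale0r.
Qed.

Lemma has_rank_le m n : has_rank m -> has_rank n -> (m <= n)%N.
Proof.
move=> [b bB] [b' b'B].
have /choice [c cP] i : exists c : 'I_n -> k, b i = \sum_j c j *: b' j.
  by have := basis_mem i bB; rewrite b'B.2 => -[c _ <-]; exists c.
have /choice [c' c'P] i : exists c : 'I_m -> k, b' i = \sum_j c j *: b j.
  by have := basis_mem i b'B; rewrite bB.2 => -[c' _ <-]; exists c'.
pose A := \matrix_(i, j) c i j; pose B := \matrix_(i, j) c' i j.
suff AB : A *m B = 1%:M by apply: mulmx1_min AB.
apply/matrixP => i l; rewrite !mxE.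
have : \sum_l0 ((\sum_j c i j * c' j l0) - (i == l0)%:R) *: b l0 = 0.
  under eq_bigr do rewrite scalerBl scaler_suml.
  rewrite sumrB exchange_big /= [X in _ - X](bigD1 i) //= eqxx scale1r.
  rewrite [X in _ - (_ + X)]big1 ?addr0; last first.
    by move=> j /negPf; rewrite eq_sym => ->; rewrite scale0r.
  apply/eqP; rewrite subr_eq0 [X in _ == X]cP; apply/eqP/eq_bigr => j _.
  by rewrite c'P scaler_sumr; apply: eq_bigr => l0 _; rewrite scalerA.
move=> /bB.1 /(_ l) /eqP; rewrite subr_eq0 => /eqP <-.
by apply: eq_bigr => j _; rewrite !mxE.
Qed.

Lemma rankP n : rank = Fin n <-> has_rank n.
Proof.
rewrite /rank; case: pselect => [ex|nex]; split=> //.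
- by case=> <-; case: (cid ex).
- move=> rn; case: (cid ex) => m rm /=; congr Fin; apply/eqP.
  by rewrite eqn_leq !has_rank_le.
- by move=> rn; case: nex; exists n.
Qed.

End Rank.

Lemma eq_rank (k : fieldType) (V W : lmodType k) (f g : {linear V -> W}) :
  f =1 g -> rank f = rank g.
Proof. by move=> /funext e; rewrite /rank /has_rank e. Qed.

Section Intervals.
Variables (d : Order.disp_t) (P : porderType d).

Definition poset_convex (A : set P) : Prop :=
  forall s u t, A s -> A t -> (s <= u)%O -> (u <= t)%O -> A u.

Definition poset_connected (A : set P) : Prop :=
  forall s t, A s -> A t -> exists p : seq P,
    [/\ forall u, u \in p -> A u, path >=<%O s p & last s p = t].

Record poset_interval := PosetInterval {
  itv_set :> set P;
  itv_nonempty : itv_set !=set0;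
  itv_convex : poset_convex itv_set;
  itv_connected : poset_connected itv_set
}.

Lemma poset_interval_inj : injective itv_set.
Proof.
move=> [A A0 Ac Ak] [B B0 Bc Bk] /= AB; move: A0 Ac Ak; rewrite AB => A0 Ac Ak.
by rewrite (Prop_irrelevance A0 B0) (Prop_irrelevance Ac Bc) (Prop_irrelevance Ak Bk).
Qed.

Definition itv_point (I : poset_interval) : subposet I :=
  let: exist p Ip := cid (itv_nonempty I) in exist _ p (mem_set Ip).

End Intervals.

Section IntervalRep.
Variables (k : fieldType) (d : Order.disp_t) (P : porderType d).
Variable I : poset_interval P.

Definition k_or_zero (b : bool) : lmodType k :=
  if b then (k^o : lmodType k) else 'rV[k]_0.

Definition k_or_zero_map (b c : bool) : {linear k_or_zero b -> k_or_zero c} :=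
  match b, c with
  | true, true => idfun : {linear k_or_zero true -> k_or_zero true}
  | b', c' => \0 : {linear k_or_zero b' -> k_or_zero c'}
  end.

Fact rep_itv_id (s : P) (ss : (s <= s)%O) x :
  k_or_zero_map (s \in itv_set I) (s \in itv_set I) x = x.
Proof.
by case: (s \in itv_set I) x => // x; rewrite [x]thinmx0 [LHS]thinmx0.
Qed.

Fact rep_itv_comp (s t u : P) (st : (s <= t)%O) (tu : (t <= u)%O)
    (su : (s <= u)%O) x :
  k_or_zero_map (t \in itv_set I) (u \in itv_set I)
    (k_or_zero_map (s \in itv_set I) (t \in itv_set I) x) =
  k_or_zero_map (s \in itv_set I) (u \in itv_set I) x.
Proof.
have : s \in itv_set I -> u \in itv_set I -> t \in itv_set I.
  by move=> /set_mem sI /set_mem uI; apply/mem_set; apply: itv_convex st tu.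
case: (s \in itv_set I) x => x; case: (u \in itv_set I);
  case: (t \in itv_set I) => //= H.
by have := H isT isT.
Qed.

Definition rep_itv : rep k P :=
  Rep (fun p => k_or_zero (p \in itv_set I))
    (fun s t _ => k_or_zero_map (s \in itv_set I) (t \in itv_set I))
    rep_itv_id rep_itv_comp.
End IntervalRep.

(* By gen_rankE, the choice of itv_point is immaterial. *)
Definition gen_rank (k : fieldType) (d : Order.disp_t) (P : porderType d)
    (I : poset_interval P) (M : rep k P) : enat :=
  rank (@lim_to_colim k d _ (restrict I M) (itv_point I)).

Lemma gen_rankE (k : fieldType) (d : Order.disp_t) (P : porderType d)
    (I : poset_interval P) (M : rep k P) (q : subposet I) :
  gen_rank I M = rank (@lim_to_colim k d _ (restrict I M) q).
Proof.
have inI (x : subposet I) : itv_set I (\val x) by apply/set_mem/(valP x).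
have [p [pI]] := itv_connected (inI (itv_point I)) (inI q).
have [p' ->] : exists p' : seq (subposet I), p = map \val p'.
  exists (pmap insub p); rewrite (pmap_filter (insubK _)); apply/esym/all_filterP.
  by apply/allP => u /pI uI; rewrite isSome_insub; apply/mem_set.
rewrite last_map path_map => pp /val_inj lp.
by apply: eq_rank => x; rewrite /= (lim_to_colim_connected _ pp lp).
Qed.

Section RankDecomposition.
Variables (d : Order.disp_t) (P : porderType d).
Variable calI : set (poset_interval P).

(* A multiset is given by its multiplicities, and may have infinite support.
   Finite multiplicities lose nothing here: an interval of infinite
   multiplicity in R has infinite generalized rank in the sum of R. *)
Definition mset : Type := calI -> nat.

Definition mset0 : mset := fun _ => 0%N.
Definition mset_inter (R S : mset) : mset := fun I => minn (R I) (S I).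
Definition mset_diff (R S : mset) : mset := fun I => (R I - S I)%N.
Definition mset_disjoint (R S : mset) : Prop := mset_inter R S = mset0.

Variable k : fieldType.

(* The index set has R I copies of each I. *)
Definition rep_mset (R : mset) : rep k P :=
  rep_dirsum (fun x : {I : calI & 'I_(R I)} => rep_itv k (\val (tag x))).

Definition gen_rank_coll (M : rep k P) : calI -> enat :=
  fun I => gen_rank (\val I) M.

Definition finite_gen_rank (M : rep k P) : Prop :=
  forall I : calI, is_finite (gen_rank_coll M I).

(* The first two conditions make fin_part lossless in the third. *)
Definition rank_decomposition (r : calI -> int) (D : mset * mset) : Prop :=
  [/\ finite_gen_rank (rep_mset D.1), finite_gen_rank (rep_mset D.2) &
      forall I : calI,
        r I = (fin_part (gen_rank_coll (rep_mset D.1) I))%:Z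
            - (fin_part (gen_rank_coll (rep_mset D.2) I))%:Z].

Definition minimal_rank_decomposition (r : calI -> int) (D : mset * mset) : Prop :=
  rank_decomposition r D /\ mset_disjoint D.1 D.2.

End RankDecomposition.

(* Main.v *)
(** The generalized rank over [I] of a direct sum of interval modules
    [k_{K j}] counts the [j] with [I] contained in [K j].  Each such [j]
    contributes a constant section of the limit and a coordinate functional on
    the colimit, and these are biorthogonal.  Any other summand vanishes at some
    point of [I]; since the map from the limit to the colimit may be computed at
    any point of the connected set [I], that summand contributes nothing.

    Hence finiteness of the rank of [k_R] at [I] says that [R] has finitely many
    elements above [I], and the rank is the sum of their multiplicities.  Such
    sums determine the multiplicities (Moebius inversion on a finite set of
    intervals).  If [(R, S)] and [(R', S')] decompose the same map, then
    [R + S' = R' + S], and disjointness of [R, S] and of [R', S'] forces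
    [R = R'] and [S = S'].  Cancelling [R] against [S] changes neither the
    finiteness nor the difference of the sums. *)
From HB Require Import structures.
Require Import Defs.
From mathcomp Require Import all_boot all_order all_algebra.
From mathcomp Require Import boolp classical_sets cardinality.
From mathcomp Require Import zify.

Set Implicit Arguments.
Unset Strict Implicit.
Unset Printing Implicit Defensive.

Import Order.TTheory GRing.Theory.
Local Open Scope classical_set_scope.
Local Open Scope ring_scope.

(** * Universal properties of direct sums and colimits *)

Section DirsumTheory.
Variables (k : fieldType) (J : eqType) (M : J -> lmodType k).

Lemma dirsum_supportP (x : dirsum M) :
  exists s : seq J, uniq s /\ forall j, (j \in s) = (\val x j != 0).
Proof.
have /asboolP/finite_seqP[s sP] := valP x.
exists (undup s); split=> [|j]; first exact: undup_uniq.
rewrite mem_undup; have sj : [set` s] j = (\val x j != 0 : Prop) by rewrite -sP.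
by apply/idP/idP => [js|xj];
  [rewrite -[is_true _]sj | rewrite -[is_true _]/([set` s] j) sj].
Qed.

Lemma dirsum_in_same i (x : M i) : \val (dirsum_in x) i = x.
Proof. exact: dfwith_in. Qed.

Lemma dirsum_in_other i j (x : M i) : i != j -> \val (dirsum_in x) j = 0.
Proof. by move=> ij; rewrite /= dfwith_out. Qed.

Lemma val_dirsum_sum I (r : seq I) (F : I -> dirsum M) j :
  \val (\sum_(i <- r) F i) j = \sum_(i <- r) \val (F i) j.
Proof. by elim/big_rec2: _ => // i x y _ <-. Qed.

Lemma dirsum_in_sum (x : dirsum M) (s : seq J) : uniq s ->
  (forall j, \val x j != 0 -> j \in s) ->
  x = \sum_(j <- s) dirsum_in (\val x j).
Proof.
move=> us xs; apply/val_inj; apply: functional_extensionality_dep => j.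
rewrite val_dirsum_sum; case: (boolP (j \in s)) => [js|njs].
  rewrite (bigD1_seq j) //= dfwith_in big1 ?addr0 // => i ij.
  by rewrite dfwith_out.
rewrite big_seq big1 => [|i si].
  by apply/eqP; apply: contraNT njs => /xs.
by rewrite dirsum_in_other //; apply: contraNneq njs => <-.
Qed.

Variables (W : lmodType k) (u : forall j, {linear M j -> W}).

Lemma dirsum_elim :
  exists g : {linear dirsum M -> W}, forall j x, g (dirsum_in x) = u j x.
Proof.
have /choice[supp suppP] := dirsum_supportP.
pose g (x : dirsum M) := \sum_(j <- supp x) u j (\val x j).
(* Every duplicate-free list containing the support gives the same sum, so linearity can be checked
   on one list for [x], [y] and [a *: x + y]. *)
have gE s x : uniq s -> (forall j, \val x j != 0 -> j \in s) ->
    g x = \sum_(j <- s) u j (\val x j).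
  move=> us xs; have [ux xP] := suppP x.
  rewrite -[RHS](big_rmcond_in (mem (supp x))) => [|j _].
    rewrite -big_filter; apply/perm_big/uniq_perm => // [|j].
      exact: filter_uniq.
    by rewrite mem_filter inE xP; case: eqVneq => //= /xs ->.
  by rewrite inE xP negbK => /eqP ->; rewrite linear0.
have g_lin : linear g.
  move=> a x y; have [ux xP] := suppP x; have [uy yP] := suppP y.
  pose s := undup (supp x ++ supp y).
  have us : uniq s by exact: undup_uniq.
  have xs j : \val x j != 0 -> j \in s by rewrite mem_undup mem_cat xP => ->.
  have ys j : \val y j != 0 -> j \in s.
    by rewrite mem_undup mem_cat yP => ->; rewrite orbT.
  have axyE j : \val (a *: x + y) j = a *: \val x j + \val y j by [].
  have axys j : \val (a *: x + y) j != 0 -> j \in s.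
    apply: contraNT => js; rewrite axyE.
    have /eqP -> : \val x j == 0 by apply: contraNT js => /xs.
    have /eqP -> : \val y j == 0 by apply: contraNT js => /ys.
    by rewrite scaler0 addr0.
  rewrite (gE s _ us xs) (gE s _ us ys) (gE s _ us axys).
  rewrite scaler_sumr -big_split; apply: eq_bigr => j _.
  by rewrite axyE linearP.
pose G : {linear dirsum M -> W} := HB.pack g (GRing.isLinear.Build k _ _ _ g g_lin).
exists G => j x /=.
rewrite (gE [:: j]) // ?big_seq1 ?dirsum_in_same // => i; rewrite inE.
by apply: contraNT; rewrite eq_sym => /dirsum_in_other ->.
Qed.

End DirsumTheory.

Lemma dirsum_map_in (k : fieldType) (J : eqType) (M N : J -> lmodType k)
    (u : forall j, {linear M j -> N j}) i (x : M i) :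
  dirsum_map u (dirsum_in x) = dirsum_in (u i x).
Proof.
apply/val_inj; apply: functional_extensionality_dep => j /=.
by case: (eqVneq i j) => [<-|ij]; rewrite ?dfwith_in // !dfwith_out ?linear0.
Qed.

Lemma colim_elim (k : fieldType) (d : Order.disp_t) (Q : porderType d)
    (M : rep k Q) (W : lmodType k) (u : forall q, {linear M q -> W}) :
  (forall s t (st : (s <= t)%O) x, u t (rep_map M st x) = u s x) ->
  exists g : {linear colim M -> W}, forall q x, g (@colim_in _ _ _ M q x) = u q x.
Proof.
move=> u_cocone; have [f fE] := dirsum_elim u.
have f_rel v : spanned (@colim_rel _ _ _ M) v -> f v = 0.
  (* The kernel of [f] is a subspace containing the relations, hence it contains their span. *)
  move=> /asboolP/(_ [set w | f w = 0]); apply=> [|a x y fx fy|_ [s [t [st [x ->]]]]].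
  - exact: linear0.
  - by rewrite /= linearP fx fy scaler0 addr0.
  - by rewrite /= linearB !fE u_cocone subrr.
have /choice[sec secP] := @quot_pi_surj _ _ (@colim_rel _ _ _ M).
pose g (y : colim M) := f (sec y).
have gE x : g (quot_pi _ x) = f x.
  by apply/eqP; rewrite -subr_eq0 -linearB f_rel //; apply/quot_piE; rewrite -secP.
have g_lin : linear g.
  move=> a x y; have [v ->] := quot_pi_surj x; have [w ->] := quot_pi_surj y.
  by rewrite -linearP !gE linearP.
pose G : {linear colim M -> W} := HB.pack g (GRing.isLinear.Build k _ _ _ g g_lin).
exists G => q x /=.
by rewrite gE fE.
Qed.

(** * Fibres of interval modules, rank bounds and finite enumerations *)

Section IntervalMap.
Variable k : fieldType.

(** The two sides could differ only if both ends are [k] and the middle is zero, which the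
    hypothesis excludes. *)
Lemma k_or_zero_map_comp (b c e : bool) (x : k_or_zero k b) : (b -> e -> c) ->
  k_or_zero_map k c e (k_or_zero_map k b c x) = k_or_zero_map k b e x.
Proof. by case: b c e x => [] [] [] //= x /(_ isT isT). Qed.

Lemma k_or_zero_eq0 (x : k_or_zero k false) : x = 0.
Proof. exact: thinmx0. Qed.

Lemma k_or_zero_unit (b : bool) (x : k_or_zero k b) : b ->
  x = (k_or_zero_map k b true x : k) *: k_or_zero_map k true b (1 : k).
Proof. by case: b x => // x _; exact: (esym (mulr1 x)). Qed.

End IntervalMap.

(** Expanding the vectors [f (v l)] in a basis of the range factors the identity matrix of size [m]
    through [k^n]. *)
Lemma has_rank_biorthogonal (k : fieldType) (V W : lmodType k)
    (f : {linear V -> W}) m n (v : 'I_m -> V) (g : 'I_m -> {linear W -> k^o}) :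
  has_rank f n -> (forall i l, g i (f (v l)) = (i == l)%:R) -> (m <= n)%N.
Proof.
move=> [b [_ bR]] gv.
have /choice[c cP] l : exists c : 'I_n -> k, f (v l) = \sum_j c j *: b j.
  have : range f (f (v l)) by exists (v l).
  by rewrite bR => -[c _ <-]; exists c.
pose A := \matrix_(l, j) c l j; pose B := \matrix_(j, i) (g i (b j) : k).
suff AB : A *m B = 1%:M by apply: mulmx1_min AB.
apply/matrixP => l i; rewrite !mxE eq_sym -gv cP linear_sum.
by apply: eq_bigr => j _; rewrite !mxE linearZ.
Qed.

(** A duplicate-free list in [A] of maximal length leaves nothing of [A] out. This turns a bound by
    the rank into finiteness of the set of summands above an interval. *)
Lemma bounded_uniq_enum (T : eqType) (A : set T) n :
  (forall s : seq T, uniq s -> (forall x, x \in s -> A x) -> (size s <= n)%N) ->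
  exists2 s : seq T, uniq s & forall x, x \in s <-> A x.
Proof.
move=> bound.
pose Q m := `[< exists s : seq T,
  [/\ uniq s, forall x, x \in s -> A x & size s = m] >].
have Q0 : exists m, Q m by exists 0%N; apply/asboolP; exists [::].
have Qn m : Q m -> (m <= n)%N.
  by move=> /asboolP[s [us sA <-]]; apply: bound.
case: (ex_maxnP Q0 Qn) => m /asboolP[s [us sA sm]] mmax.
exists s => // x; split=> [|Ax]; first exact: sA.
apply: contraT => xs; have : Q m.+1.
  apply/asboolP; exists (x :: s); split=> [|y|] /=; rewrite ?xs ?us ?sm //.
  by rewrite inE => /predU1P[->|/sA].
by move=> /mmax; rewrite ltnn.
Qed.

(** * Generalized rank of a direct sum of interval modules *)

Section GenRankIntervalSum.
Variables (k : fieldType) (d : Order.disp_t) (P : porderType d).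
Variable I : poset_interval P.

Lemma lim_to_colim_itv (M : rep k P) (p q : subposet I) :
  lim_to_colim (M := restrict I M) p = lim_to_colim q.
Proof.
have inI (x : subposet I) : itv_set I (\val x) by apply/set_mem/(valP x).
have [s [sI ps ls]] := itv_connected (inI p) (inI q).
have [t st] : exists t : seq (subposet I), s = map \val t.
  exists (pmap insub s); rewrite (pmap_filter (insubK _)); apply/esym/all_filterP.
  by apply/allP => u /sI uI; rewrite isSome_insub; apply/mem_set.
rewrite {}st path_map last_map in ps ls.
exact: lim_to_colim_connected ps (val_inj ls).
Qed.

Variables (J : eqType) (K : J -> poset_interval P).
Let M := rep_dirsum (fun j => rep_itv k (K j)).
Let N := restrict I M.
Let unit_at j (q : subposet I) : k_or_zero k (\val q \in itv_set (K j)) :=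
  k_or_zero_map k true _ (1 : k).

Lemma lim_constant j : I `<=` K j ->
  exists x : lim N, forall q, lim_proj q x =
    @dirsum_in k J (fun j => k_or_zero k (\val q \in itv_set (K j))) j (unit_at j q).
Proof.
move=> IK; pose f : prodmod N := fun q =>
  @dirsum_in k J (fun j => k_or_zero k (\val q \in itv_set (K j))) j (unit_at j q).
have f_comp : compatible f.
  apply/asboolP => s t st; rewrite /f /= dirsum_map_in /=.
  congr dirsum_in; apply: k_or_zero_map_comp => _ _.
  exact/mem_set/IK/set_mem/(valP s).
by exists (Sub f f_comp).
Qed.

(** Structure maps of a direct sum act componentwise, so a section can be cut down to one summand
    and then evaluated at another point of [I]. *)
Lemma lim_component (x : lim N) j :
  exists y : lim N, forall q, lim_proj q y = dirsum_in (\val (lim_proj q x) j).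
Proof.
pose f : prodmod N := fun q => dirsum_in (\val (lim_proj q x) j).
have f_comp : compatible f.
  apply/asboolP => s t st; rewrite /f /= dirsum_map_in -(lim_projP st).
  by [].
by exists (Sub f f_comp).
Qed.

(** Over [I] the [j]-th summand is constantly [k], so its coordinate is preserved by the structure
    maps and passes to the colimit. *)
Lemma colim_coordinate j : I `<=` K j ->
  exists g : {linear colim N -> k^o}, forall q (y : N q),
    g (colim_in y) = k_or_zero_map k _ true (\val y j).
Proof.
move=> IK.
pose u (q : subposet I) (y : N q) : k^o := k_or_zero_map k _ true (\val y j).
have u_lin q : linear (u q).
  move=> a x y; rewrite /u.
  have -> : \val (a *: x + y) j = a *: \val x j + \val y j by [].
  by rewrite linearP.
pose U q : {linear N q -> k^o} :=
  HB.pack (u q) (GRing.isLinear.Build k _ _ _ (u q) (u_lin q)).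
apply: (@colim_elim _ _ _ N _ U) => s t st x.
apply: (@k_or_zero_map_comp k _ (\val t \in itv_set (K j)) true (\val x j)) => _ _.
exact/mem_set/IK/set_mem/(valP t).
Qed.

Section RankAt.
Variable q : subposet I.

Lemma lim_to_colim_component_eq0 (x : lim N) j : ~ I `<=` K j ->
  colim_in (M := N) (q := q) (dirsum_in (\val (lim_proj q x) j)) = 0.
Proof.
move=> /existsNP[p /not_implyP[Ip Kp]]; have [y yE] := lim_component x j.
pose p' : subposet I := exist _ p (mem_set Ip).
(* The base point moves from [q] to a point of [I] outside [K j], where the fibre is zero. *)
rewrite -yE -[LHS]/(lim_to_colim q y) (lim_to_colim_itv M q p') /lim_to_colim yE.
suff -> : \val (lim_proj p' x) j = 0 by rewrite !linear0.
move: (\val (lim_proj p' x) j) => /=; have /negPf -> : p \notin itv_set (K j).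
  by apply/negP => /set_mem.
exact: k_or_zero_eq0.
Qed.

(** Biorthogonality bounds the rank from below and gives independence; the two evaluation formulas
    serve to show that the images span. *)
Lemma biorthogonal_above (s : seq J) : (forall j, j \in s -> I `<=` K j) -> uniq s ->
  exists (v : 'I_(size s) -> lim N) (g : 'I_(size s) -> {linear colim N -> k^o}),
  [/\ forall i l, g i (lim_to_colim q (v l)) = (i == l)%:R,
      forall i y, g i (colim_in (M := N) (q := q) y) =
        k_or_zero_map k _ true (\val y (tnth (in_tuple s) i)) &
      forall i, lim_proj q (v i) =
        @dirsum_in k J (fun j => k_or_zero k (\val q \in itv_set (K j))) _
          (unit_at (tnth (in_tuple s) i) q)].
Proof.
move=> sI us; pose t i := tnth (in_tuple s) i.
have tI i : I `<=` K (t i) by apply: sI; exact: mem_tnth.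
have /choice[v vE] i := lim_constant (tI i).
have /choice[g gE] i := colim_coordinate (tI i).
exists v, g; split=> // i l.
rewrite /lim_to_colim gE vE; case: (eqVneq i l) => [<-|il].
  rewrite dirsum_in_same /unit_at.
  have -> : \val q \in itv_set (K (t i)) by apply/mem_set/tI/set_mem/(valP q).
  by [].
rewrite dirsum_in_other ?linear0 //; apply: contra il => /eqP til.
apply/eqP/val_inj; move: til.
by rewrite /t !(tnth_nth (t i)) /= => /eqP; rewrite nth_uniq // eq_sym => /eqP.
Qed.

Lemma has_rank_enum (s : seq J) : uniq s -> (forall j, j \in s <-> I `<=` K j) ->
  has_rank (lim_to_colim (M := N) q) (size s).
Proof.
move=> us sP; pose t i := tnth (in_tuple s) i.
have [v [g [gv gE vE]]] := biorthogonal_above (fun j => (sP j).1) us.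
exists (fun i => lim_to_colim q (v i)); split=> [c c0 i|].
  have := congr1 (g i) c0; rewrite linear0 linear_sum (bigD1 i) //= big1.
    by rewrite linearZ gv eqxx addr0 /= => <-; exact: (esym (mulr1 _)).
  by move=> l li; rewrite linearZ gv eq_sym (negPf li) /= scaler0.
apply/seteqP; split=> [_ [x _ <-]|_ [c _ <-]]; last first.
  by exists (\sum_i c i *: v i); rewrite // linear_sum;
    apply: eq_bigr => i _; rewrite linearZ.
pose c i : k := g i (lim_to_colim q x); exists c => //.
have [r [ur rP]] := dirsum_supportP (lim_proj q x).
(* This list contains both the support of [x] at [q] and [s], so discarding the components outside
   [s] leaves a permutation of [s]. *)
pose l := undup (r ++ s).
have fxE : lim_to_colim q x =
    \sum_(j <- l) colim_in (M := N) (q := q) (dirsum_in (\val (lim_proj q x) j)).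
  rewrite /lim_to_colim {1}(@dirsum_in_sum _ _ _ (lim_proj q x) l) ?undup_uniq //.
    by rewrite linear_sum.
  by move=> j xj; rewrite mem_undup mem_cat rP xj.
apply/esym/(etrans fxE); rewrite -(big_rmcond_in (mem s)) => [|j _ js]; last first.
  by apply: lim_to_colim_component_eq0 => /sP; apply/negP.
rewrite -big_filter (perm_big s) /=; last first.
  apply: uniq_perm => // [|j]; first by rewrite filter_uniq ?undup_uniq.
  by rewrite mem_filter mem_undup mem_cat inE; case: (j \in s); rewrite ?orbT.
rewrite (big_tnth _ _ s); apply: eq_bigr => i _.
have qi : \val q \in itv_set (K (t i)).
  by apply/mem_set/(sP _).1; [exact: mem_tnth | exact/set_mem/(valP q)].
have xi : \val (lim_proj q x) (t i) = c i *: unit_at (t i) q.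
  by rewrite /c /lim_to_colim gE; exact: k_or_zero_unit.
by rewrite xi /lim_to_colim vE !linearZ.
Qed.

End RankAt.

Lemma gen_rank_itv_sumP n :
  gen_rank I M = Fin n <->
  exists s : seq J, [/\ uniq s, size s = n & forall j, j \in s <-> I `<=` K j].
Proof.
set q := itv_point I; split=> [/rankP rn|[s [us <- sP]]]; last first.
  by apply/rankP; exact: has_rank_enum.
(* Biorthogonal families are no longer than the rank [n], so only finitely many indices [j] have
   [K j] above [I]. *)
have [s us sP] : exists2 s : seq J, uniq s & forall j, j \in s <-> I `<=` K j.
  apply: (@bounded_uniq_enum _ _ n) => s us sI.
  have [v [g [gv _ _]]] := biorthogonal_above q sI us.
  exact: has_rank_biorthogonal rn gv.
exists s; split=> //; have rs := has_rank_enum q us sP.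
by apply/eqP; rewrite eqn_leq (has_rank_le rn rs) (has_rank_le rs rn).
Qed.

End GenRankIntervalSum.

(** Equality is decided classically, so that intervals can be listed without repetition. *)
HB.instance Definition _ (d : Order.disp_t) (P : porderType d) :=
  gen_eqMixin (poset_interval P).
HB.instance Definition _ (d : Order.disp_t) (P : porderType d) :=
  gen_choiceMixin (poset_interval P).

(** * Multiplicities determined by generalized ranks *)

Section Multisets.
Variables (k : fieldType) (d : Order.disp_t) (P : porderType d).
Variable calI : set (poset_interval P).
Implicit Types (R S : mset calI) (I J : calI) (F : seq calI).

Notation below I J := (itv_set (\val I) `<=` itv_set (\val J)).

(** The list may contain intervals of multiplicity zero, so that one list can serve several
    multisets at once. *)
Definition covers_above I R F :=
  [/\ uniq F, forall J, J \in F -> below I J &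
      forall J, below I J -> (0 < R J)%N -> J \in F].

Lemma covers_above_sub I R S F : (forall J, (0 < S J)%N -> (0 < R J)%N) ->
  covers_above I R F -> covers_above I S F.
Proof. by move=> SR [uF FI IF]; split=> // J IJ /SR; exact: IF. Qed.

Lemma covers_aboveU I R S F G : covers_above I R F -> covers_above I S G ->
  covers_above I (fun J => (R J + S J)%N) (undup (F ++ G)).
Proof.
move=> [_ FI IF] [_ GI IG]; split=> [|J|J IJ]; rewrite ?undup_uniq //.
  by rewrite mem_undup mem_cat => /orP[/FI|/GI].
by rewrite mem_undup mem_cat addn_gt0 => /orP[/IF ->|/IG ->]; rewrite ?orbT.
Qed.

Lemma gen_rank_mset I R F : covers_above I R F ->
  gen_rank (\val I) (rep_mset k R) = Fin (\sum_(J <- F) R J).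
Proof.
move=> [uF FI IF]; apply/gen_rank_itv_sumP.
(* The summands above [I] are the pairs of an interval [J] in [F] and the number of one of its
   copies. *)
exists [seq Tagged (fun J => 'I_(R J)) i | J <- F, i <- enum 'I_(R J)]; split.
- apply: allpairs_uniq_dep => // [J _|[J i] [J' i'] _ _] //.
  exact: enum_uniq.
- rewrite size_allpairs_dep sumnE big_map; apply: eq_bigr => J _.
  exact: size_enum_ord.
- move=> [J i]; split=> [/allpairsPdep[J' [i' [J'F _ /(congr1 tag) /= ->]]]|IJ].
    exact: FI.
  apply/allpairsPdep; exists J, i; rewrite mem_enum; split=> //.
  by apply: IF => //; exact: leq_ltn_trans (ltn_ord i).
Qed.

Lemma finite_gen_rank_covered I R :
  is_finite (gen_rank (\val I) (rep_mset k R)) -> exists F, covers_above I R F.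
Proof.
case rI: (gen_rank _ _) => [n|//] _.
have [s [us _ sP]] := (gen_rank_itv_sumP _ _ _ _).1 rI.
exists (undup (map tag s)); split=> [|J|J IJ RJ]; rewrite ?undup_uniq //.
  by rewrite mem_undup => /mapP[x /sP Ix ->].
rewrite mem_undup; apply/mapP.
(* Positive multiplicity provides the copy numbered 0, which witnesses that [J] is listed. *)
by exists (Tagged (fun J => 'I_(R J)) (Ordinal RJ)) => //; apply/sP.
Qed.

(** A list covering the sum of [R] and [S] covers each of them, so both ranks are finite sums over
    the same list. *)
Lemma covers_above_rank_decomposition (r : calI -> int) R S :
  (forall I, exists2 F, covers_above I (fun J => (R J + S J)%N) F &
     r I = (\sum_(J <- F) R J)%N%:Z - (\sum_(J <- F) S J)%N%:Z) ->
  rank_decomposition k r (R, S).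
Proof.
move=> RS; suff RkE I : exists F,
  [/\ gen_rank_coll (rep_mset k R) I = Fin (\sum_(J <- F) R J),
    gen_rank_coll (rep_mset k S) I = Fin (\sum_(J <- F) S J) &
    r I = (\sum_(J <- F) R J)%N%:Z - (\sum_(J <- F) S J)%N%:Z].
  by split=> I; have [F [RF SF rF]] := RkE I; rewrite /= ?RF ?SF.
have [F cF rF] := RS I; exists F; split=> //; apply/gen_rank_mset;
  by apply: covers_above_sub cF => J; rewrite addn_gt0 => ->; rewrite ?orbT.
Qed.

Lemma rank_decomposition_covers_above (r : calI -> int) R S :
  rank_decomposition k r (R, S) -> forall I,
  (exists F, covers_above I (fun J => (R J + S J)%N) F) /\
  (forall F, covers_above I (fun J => (R J + S J)%N) F ->
     r I = (\sum_(J <- F) R J)%N%:Z - (\sum_(J <- F) S J)%N%:Z).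
Proof.
move=> [/= Rfin Sfin rRS] I; split=> [|F cF].
  have [F cF] := finite_gen_rank_covered (Rfin I).
  have [G cG] := finite_gen_rank_covered (Sfin I).
  by exists (undup (F ++ G)); exact: covers_aboveU.
rewrite rRS /gen_rank_coll !(@gen_rank_mset I _ F) //;
  by apply: covers_above_sub cF => J; rewrite addn_gt0 => ->; rewrite ?orbT.
Qed.

(* Induction on the number of intervals covering [I]: those strictly above [I]
   have fewer, so their multiplicities agree and cancel in the sum at [I]. *)
Lemma mset_eq_of_sums R S :
  (forall I, exists F, covers_above I (fun J => (R J + S J)%N) F) ->
  (forall I F, covers_above I (fun J => (R J + S J)%N) F ->
     \sum_(J <- F) R J = \sum_(J <- F) S J)%N ->
  R =1 S.
Proof.
move=> fin sumE I; have [F] := fin I; have [n] := ubnP (size F).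
elim: n I F => // n IHn I F Fn cF; have [uF FI IF] := cF.
(* If [F] omits [I], both multiplicities at [I] vanish. *)
have [inF|/negP notF] := boolP (I \in F); last first.
  by apply/eqP; apply: contraT => RS; case: notF; apply: IF => //; lia.
have := sumE _ _ cF; rewrite !(perm_big _ (perm_to_rem inF)) !big_cons /=.
suff -> : (\sum_(J <- rem I F) R J = \sum_(J <- rem I F) S J)%N by move/addIn.
apply: eq_big_seq => J; rewrite mem_rem_uniq // inE => /andP[JI JF].
pose G := [seq H <- F | `[< below J H >]].
have GF : {subset G <= rem I F}.
  move=> H; rewrite mem_filter mem_rem_uniq // inE => /andP[/asboolP JH HF].
  (* If [I] were in [G], then [J] would lie in [I]; since [I] lies in [J], the two would
     coincide. *)
  rewrite HF andbT; apply: contra_neq JI => HI; apply/val_inj/poset_interval_inj.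
  by apply/seteqP; split; [rewrite -HI | exact: FI].
apply: (IHn J G).
  rewrite -ltnS (leq_trans _ Fn) // ltnS.
  have := uniq_leq_size (filter_uniq _ uF) GF; rewrite size_rem //.
  have : (0 < size F)%N by case: (F) inF.
  by case: (size F).
split=> [|H|H JH RSH]; rewrite ?filter_uniq // mem_filter.
  by move=> /andP[/asboolP].
by rewrite asboolT //= IF //; exact: subset_trans (FI _ JF) JH.
Qed.

End Multisets.

Theorem mainTheorem1 (k : fieldType) (d : Order.disp_t) (P : porderType d)
    (calI : set (poset_interval P)) (r : calI -> int) :
  (forall D D' : mset calI * mset calI,
     minimal_rank_decomposition k r D -> minimal_rank_decomposition k r D' ->
     D = D') /\
  (forall R S : mset calI,
     rank_decomposition k r (R, S) ->
     minimal_rank_decomposition k r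
       (mset_diff R (mset_inter R S), mset_diff S (mset_inter R S))).
Proof.
split=> [[R S] [R' S'] [/rank_decomposition_covers_above rRS dRS]
    [/rank_decomposition_covers_above rRS' dRS']|R S rRS].
  have sumE : (fun J => R J + S' J)%N =1 (fun J => R' J + S J)%N.
    apply: mset_eq_of_sums => [I|I F cF].
      have [[F cF] _] := rRS I; have [[F' cF'] _] := rRS' I.
      exists (undup (F ++ F')).
      by apply: covers_above_sub (covers_aboveU cF cF') => J; lia.
    have cRS : covers_above I (fun J => (R J + S J)%N) F.
      by apply: covers_above_sub cF => J; lia.
    have cRS' : covers_above I (fun J => (R' J + S' J)%N) F.
      by apply: covers_above_sub cF => J; lia.
    have := (rRS I).2 F cRS; rewrite ((rRS' I).2 F cRS') !big_split /=; lia.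
  (* At each [J] one of [R J], [S J] is zero, and one of [R' J], [S' J], so
     [R J + S' J = R' J + S J] forces both equalities. *)
  suff RSE J : R J = R' J /\ S J = S' J.
    by congr pair; apply/funext => J; have [] := RSE J.
  have := congr1 (@^~ J) dRS; have := congr1 (@^~ J) dRS'; have := sumE J.
  by rewrite /mset_inter /mset0 /=; lia.
split; last by apply/funext => J; rewrite /mset_inter /mset_diff /mset0 /=; lia.
apply: covers_above_rank_decomposition => I.
have [[F cF] rE] := rank_decomposition_covers_above rRS I.
exists F; first by apply: covers_above_sub cF => J; rewrite /mset_diff; lia.
(* The intersection lies below both [R] and [S], so its sum splits off from each and cancels in the
   difference. *)
have splitE (A B : mset calI) : (forall J, B J <= A J)%N ->
    (\sum_(J <- F) A J = \sum_(J <- F) mset_diff A B J + \sum_(J <- F) B J)%N.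
  by move=> BA; rewrite -big_split; apply: eq_bigr => J _; exact: esym (subnK (BA J)).
rewrite (rE F cF) (splitE R (mset_inter R S)) => [|J]; last exact: geq_minl.
rewrite (splitE S (mset_inter R S)) => [|J]; last exact: geq_minr.
lia.
Qed.
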